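(* The inclusion $bs^{\lambda}\subset bs$ holds if and only if $S(x)\in bs$ for every sequence $x\in bs^{\lambda}$.
   Context: $\mathbb{N}=\{0,1,2,\dots\}$ and $w=\mathbb{C}^{\mathbb{N}}$ is the space of all complex sequences. $\lambda=(\lambda_k)_{k\in\mathbb{N}}$ is a fixed strictly increasing sequence of positive reals tending to infinity, with the convention $\lambda_{-1}=0$. For $x=(x_k)\in w$ put $\Lambda(x)=(\Lambda_n(x))_{n\in\mathbb{N}}$, $\Lambda_n(x)=\frac{1}{\lambda_n}\sum_{k=0}^{n}(\lambda_k-\lambda_{k-1})x_k$, and $S(x)=(S_n(x))_{n\in\mathbb{N}}$, where $S_0(x)=0$ and $S_n(x)=\frac{1}{\lambda_n}\sum_{k=1}^{n}\lambda_{k-1}(x_k-x_{k-1})$ for $n\geq 1$. $bs$ is the space of sequences $x\in w$ such that $\sup_m\left|\sum_{n=0}^m x_n\right|<\infty$, and $bs^{\lambda}=\{x\in w:\Lambda(x)\in bs\}$. *)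

(* Defs.v *)
From Stdlib Require Import Reals.
From Coquelicot Require Import Coquelicot.

Open Scope R_scope.

Definition lambda_seq (lambda : nat -> R) : Prop :=
  (forall k : nat, 0 < lambda k) /\
  (forall k : nat, lambda k < lambda (S k)) /\
  is_lim_seq lambda p_infty.

(* [lambda_pred lambda k] is lambda_{k-1}, with the convention lambda_{-1} = 0. *)
Definition lambda_pred (lambda : nat -> R) (k : nat) : R :=
  match k with
  | O => 0
  | S j => lambda j
  end.

Definition Lambda_mean (lambda : nat -> R) (x : nat -> C) (n : nat) : C :=
  (RtoC (/ lambda n) *
   sum_n (fun k : nat => RtoC (lambda k - lambda_pred lambda k) * x k) n)%C.

(* The summation index satisfies k >= 1, so [pred k] is a genuine k - 1. *)
Definition S_mean (lambda : nat -> R) (x : nat -> C) (n : nat) : C :=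
  match n with
  | O => RtoC 0
  | S _ =>
      (RtoC (/ lambda n) *
       sum_n_m (fun k : nat =>
                  RtoC (lambda_pred lambda k) * (x k - x (Nat.pred k))) 1 n)%C
  end.

Definition bs (x : nat -> C) : Prop :=
  Rbar_lt (Sup_seq (fun m : nat => Finite (Cmod (sum_n x m)))) p_infty.

Definition bs_lambda (lambda : nat -> R) (x : nat -> C) : Prop :=
  bs (Lambda_mean lambda x).

(* Main.v *)
(* Summation by parts gives S_n(x) = x_n - Lambda_n(x); since bs is closed under sums and differences,
   for x with Lambda(x) in bs the conditions x in bs and S(x) in bs are equivalent. *)

Require Import Defs.
From Stdlib Require Import Reals Lia.
From Coquelicot Require Import Coquelicot.

(** Abel summation splits every sequence termwise as [x = Lambda_mean lambda x + S_mean lambda x]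
    ([Lambda_mean_plus_S_mean]). Since [bs] is closed under sums and negation ([bs_plus], [bs_opp]),
    once the first summand lies in [bs], [x] and the second summand lie in [bs] together. The
    equivalence thus holds for each [x] separately. [bs_bounded] trades the extended supremum for a
    real bound, so that closure follows from the triangle inequality. *)

Lemma bs_bounded (x : nat -> C) :
  bs x <-> exists M : R, forall m : nat, Cmod (sum_n x m) <= M.
Proof.
unfold bs; set (u := fun m : nat => Finite (Cmod (sum_n x m))).
split.
- intros Hlt.
  pose proof (Sup_seq_correct u) as Hsup.
  destruct (Sup_seq u) as [M | |]; simpl in Hlt.
  + exists M; intros m.
    apply (proj1 (is_sup_seq_lub u M Hsup) (u m)); now exists m.
  + contradiction.
  (* A supremum of minus infinity would put every term below every real, hence the term at 0 below
     itself. *)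
  + exfalso; exact (Rlt_irrefl _ (Hsup (Cmod (sum_n x 0)) 0%nat)).
- intros [M HM].
  apply Rbar_le_lt_trans with (Finite M); [ | exact I].
  rewrite Rbar_sup_eq_lub.
  unfold Rbar_lub; destruct (Rbar_ex_lub _) as [l [Hub Hlub]]; simpl.
  apply Hlub; intros y [m ->]; exact (HM m).
Qed.

Lemma bs_plus (x y : nat -> C) :
  bs x -> bs y -> bs (fun n => x n + y n)%C.
Proof.
rewrite !bs_bounded; intros [M HM] [N HN]; exists (M + N); intros m.
change (sum_n (fun n => x n + y n)%C m) with (sum_n (fun n => plus (x n) (y n)) m).
rewrite sum_n_plus.
apply Rle_trans with (1 := Cmod_triangle _ _).
now apply Rplus_le_compat.
Qed.

Lemma bs_opp (x : nat -> C) : bs x -> bs (fun n => - x n)%C.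
Proof.
rewrite !bs_bounded; intros [M HM]; exists M; intros m.
replace (sum_n (fun n => - x n)%C m) with (- sum_n x m)%C.
- now rewrite Cmod_opp.
- induction m as [|m IH].
  + now rewrite !sum_O.
  + rewrite !sum_Sn, <- IH; unfold plus; simpl; ring.
Qed.

Lemma bs_ext (x y : nat -> C) : (forall n, x n = y n) -> bs x -> bs y.
Proof.
rewrite !bs_bounded; intros Hxy [M HM]; exists M; intros m.
now rewrite <- (sum_n_ext _ _ _ Hxy).
Qed.

(** Passing from n to n+1 adds (λ_{n+1} - λ_n) x_{n+1} + λ_n (x_{n+1} - x_n) = λ_{n+1} x_{n+1} - λ_n
    x_n, so the sum telescopes. At n = 0 the second sum is empty and λ_{-1} = 0. *)
Lemma summation_by_parts (lambda : nat -> R) (x : nat -> C) (n : nat) :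
  (sum_n (fun k => RtoC (lambda k - lambda_pred lambda k) * x k) n +
   sum_n_m (fun k => RtoC (lambda_pred lambda k) * (x k - x (Nat.pred k))) 1 n
   = RtoC (lambda n) * x n)%C.
Proof.
induction n as [|n IH].
- rewrite sum_O, sum_n_m_zero by lia; unfold zero; simpl.
  rewrite RtoC_minus; ring.
- rewrite sum_Sn, sum_n_Sm by lia; unfold plus; simpl.
  rewrite RtoC_minus.
  set (A := sum_n _ n) in *; set (B := sum_n_m _ 1 n) in *.
  replace A with (RtoC (lambda n) * x n - B)%C by (rewrite <- IH; ring).
  ring.
Qed.

Lemma Lambda_mean_plus_S_mean (lambda : nat -> R) (x : nat -> C) (n : nat) :
  lambda n <> 0 -> (Lambda_mean lambda x n + S_mean lambda x n = x n)%C.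
Proof.
intros Hn.
(* The closed formula also covers n = 0, where the sum from 1 to 0 is empty and matches the separate
   value 0 in [S_mean]. *)
replace (S_mean lambda x n) with
  (RtoC (/ lambda n) *
   sum_n_m (fun k => RtoC (lambda_pred lambda k) * (x k - x (Nat.pred k))) 1 n)%C.
- unfold Lambda_mean.
  rewrite <- Cmult_plus_distr_l, summation_by_parts, Cmult_assoc, <- RtoC_mult.
  rewrite Rinv_l by exact Hn; ring.
- destruct n; [ | reflexivity].
  rewrite sum_n_m_zero by lia; apply Cmult_0_r.
Qed.

Theorem theorem3p7 (lambda : nat -> R) (Hlambda : lambda_seq lambda) :
  (forall x : nat -> C, bs_lambda lambda x -> bs x) <->
  (forall x : nat -> C, bs_lambda lambda x -> bs (S_mean lambda x)).
Proof.
destruct Hlambda as [Hpos _].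
assert (Hdec : forall x n, (Lambda_mean lambda x n + S_mean lambda x n = x n)%C).
{ intros x n; apply Lambda_mean_plus_S_mean, Rgt_not_eq, Hpos. }
split; intros H x Hx; specialize (H x Hx); unfold bs_lambda in Hx.
- apply bs_ext with (fun n => x n + - Lambda_mean lambda x n)%C.
  + intros n; rewrite <- (Hdec x n) at 1; ring.
  + now apply bs_plus; [ | apply bs_opp].
- apply bs_ext with (1 := Hdec x).
  now apply bs_plus.
Qed.
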